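(* Let $r=r(n)\ge 2$ be integer valued with $r$ dividing $2n$, and let $M_n$ be a sequence of perfect matchings of $K_{r\times 2n/r}$. Let $R_n$ be a uniformly random perfect matching of $K_{r\times 2n/r}$ and let $X=X(M_n)$ be the number of edges shared by $M_n$ and $R_n$. Then \[\mathrm{d}_{\mathrm{TV}}\left(X,\mathrm{Po}\left(\frac{r}{2r-2}\right)\right)\to 0\] as $n\to\infty$.
   Context: $K_{r\times 2n/r}$ denotes the complete $r$-partite graph with $r$ parts each of size $2n/r$. For integer-valued random variables $X,Y$, the total variation distance is $\mathrm{d}_{\mathrm{TV}}(X,Y)=\frac12\sum_{k\in\mathbb{Z}}|\Pr(X=k)-\Pr(Y=k)|$. $\mathrm{Po}(\lambda)$ denotes a Poisson random variable with parameter $\lambda$. *)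

(* Defs.v *)
From HB Require Import structures.
From mathcomp Require Import all_boot all_order all_algebra.
From mathcomp Require Import all_classical all_reals all_analysis.

Set Implicit Arguments.
Unset Strict Implicit.
Unset Printing Implicit Defensive.

Import Order.TTheory GRing.Theory Num.Theory.
Import numFieldNormedType.Exports.

Local Open Scope ring_scope.

(* A simple graph is given by its (symmetric, irreflexive) adjacency relation;
   its edges are two-element vertex sets. *)
Definition edges (V : finType) (e : rel V) : {set {set V}} :=
  [set E : {set V} | [exists u, exists v, e u v && (E == [set u; v]%SET)]]%SET.

Definition perfect_matching (V : finType) (e : rel V) (M : {set {set V}}) : bool :=
  (M \subset edges e) && finset.partition M [set: V]%SET.

Definition perfect_matchings (V : finType) (e : rel V) : {set {set {set V}}} :=
  [set M : {set {set V}} | perfect_matching e M]%SET.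

(* The vertex (i, a) is the a-th vertex of the i-th part. *)
Definition multipartite_vertex (r m : nat) : finType := ('I_r * 'I_m)%type.

Definition complete_multipartite (r m : nat) : rel (multipartite_vertex r m) :=
  fun u v => u.1 != v.1.

(* The random element Z of the finite type S is uniformly distributed on A. *)
Definition uniformly_distributed (R : realType) (d : measure_display)
    (T : measurableType d) (P : probability T R) (S : finType) (A : {set S})
    (Z : T -> S) : Prop :=
  forall s : S, measurable (Z @^-1` [set s])%classic /\
    P (Z @^-1` [set s])%classic = (if s \in A then #|A|%:R^-1 else 0)%:E.

(* X and Y may live on different probability spaces. *)
Definition dTV (R : realType)
    (d : measure_display) (T : measurableType d) (P : probability T R) (X : T -> int)
    (d' : measure_display) (T' : measurableType d') (Q : probability T' R)
    (Y : T' -> int) : \bar R :=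
  ((2^-1)%:E * \esum_(k in [set: int])
     `|P (X @^-1` [set k]) - Q (Y @^-1` [set k])|)%classic%E.

(* The last argument of poisson_prob is a dummy: the measure does not depend on
   it.  A Poisson random variable with parameter lambda is the inclusion
   Posz : nat -> int on the probability space (nat, Po lambda). *)
Definition Po (R : realType) (lambda : R) : probability nat R :=
  poisson_prob lambda 0.

(* Main.v *)
(* Factorial moments.  If [N A] counts the perfect matchings of a vertex set [A],
   then [k] given edges of [M] all lie in [R_n] with probability
   [N (V minus their ends) / N V], so it is enough to show that removing the two
   ends of an edge divides [N] by [(1 + o(1)) L], where [L = (r - 1) (2n / r)] is
   the degree.  Since [N A] is the sum of [N (A - u - v)] over the neighbours [v]
   of [u], for [r >= 4] this follows once these summands are nearly equal.  The
   difference of two of them obeys a recursion whose coefficients are controlled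
   by a switching bound, because the colour classes of [A] have nearly equal
   sizes.  For [r <= 3] the number of edges of a matching between two classes is
   determined by the class sizes, which gives [N (A - u - v) / N A] exactly.
   Hence the [k]-th factorial moment of [X] tends to [(n / L)^k], with
   [n / L = r / (2r - 2)], and Bonferroni's inequalities conclude. *)

Require Import Defs.
From HB Require Import structures.
From mathcomp Require Import all_boot all_order all_algebra.
From mathcomp Require Import all_classical all_reals all_analysis.
From mathcomp Require Import ring lra zify.

Set Implicit Arguments.
Unset Strict Implicit.
Unset Printing Implicit Defensive.

Import Order.TTheory GRing.Theory Num.Theory.
Import numFieldNormedType.Exports.

Local Open Scope ring_scope.

(** * Recursion for the number of matchings *)

Section MatchingCounts.
Context (R : realFieldType) (V : finType) (I : eqType) (c : V -> I).
Context (N : {set V} -> R) (N_ge0 : forall A, 0 <= N A).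
Context (N_rec : forall (A : {set V}) u, u \in A ->
  N A = \sum_(v in A | c v != c u) N (A :\ u :\ v)).

Implicit Types (A B C : {set V}) (u v w x y z : V).

Lemma setD1C A u v : A :\ u :\ v = A :\ v :\ u.
Proof. by rewrite !finset.setDDl finset.setUC. Qed.

(** Expanding [N (B :\ w1)] at [w2] omits exactly the [z] of colour [c w2]; restoring them gives the
    sum of [N (B :\ w1 :\ w2 :\ z)] over all [z], which is symmetric in [w1] and [w2]. *)
Lemma count_exchange B w1 w2 : w1 \in B -> w2 \in B -> w1 != w2 ->
  N (B :\ w1) + \sum_(z in B :\ w1 :\ w2 | c z == c w2) N (B :\ w1 :\ w2 :\ z) =
  N (B :\ w2) + \sum_(z in B :\ w1 :\ w2 | c z == c w1) N (B :\ w1 :\ w2 :\ z).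
Proof.
have half a b : b \in B -> a != b ->
    N (B :\ a) + \sum_(z in B :\ a :\ b | c z == c b) N (B :\ a :\ b :\ z) =
    \sum_(z in B :\ a :\ b) N (B :\ a :\ b :\ z).
  move=> bB ab; rewrite [RHS](bigID (fun z => c z == c b)) /= addrC; congr (_ + _).
  rewrite (@N_rec (B :\ a) b) ?inE 1?eq_sym ?ab//.
  by apply: eq_bigl => z; rewrite !inE; case: (z =P b) => [->|]//; rewrite eqxx andbF.
move=> w1B w2B w12; rewrite half// setD1C half// eq_sym//.
Qed.

(** For equal colours the two sums in the exchange identity coincide and cancel. As [N] is known
    only through its recursion, this stands in for the automorphism swapping [w1] and [w2]. *)
Lemma count_same_colour B w1 w2 : w1 \in B -> w2 \in B -> c w1 = c w2 ->
  N (B :\ w1) = N (B :\ w2).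
Proof.
move=> w1B w2B cw; have [->//|w12] := eqVneq w1 w2.
by have := count_exchange w1B w2B w12; rewrite cw; apply: addIr.
Qed.

Lemma sum_count_colour C y : y \in C ->
  \sum_(z in C | c z == c y) N (C :\ z) =
  #|[set z in C | c z == c y]|%:R * N (C :\ y).
Proof.
move=> yC; rewrite (eq_bigr (fun=> N (C :\ y))); last first.
  by move=> z /andP[zC /eqP cz]; exact: count_same_colour.
rewrite big_const -Monoid.iteropE /= mulr_natl; congr (_ *+ _).
by apply: eq_card => z; rewrite !inE.
Qed.

(* Switching: in a matching of [A - u - v], an oriented edge [xy] with [x] not of
   the colour of [u] and [y] not of the colour of [v] can be replaced by [ux] and
   [vy]; the bound [(1 - al x) * (1 - be y) >= 1 - al x - be y] counts them. *)
Lemma count_avoid A u v : u \in A -> v \in A -> c u != c v ->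
  #|[set z in A | (c z != c u) && (c z != c v)]|%:R * N (A :\ u :\ v) <= N A.
Proof.
move=> uA vA cuv; set A' := A :\ u :\ v.
have uv : u != v by apply: contraNneq cuv => ->.
(* [F x y] plays the number of matchings of [A'] that contain the edge [xy], so its row sums are
   [N A']. *)
pose F x y := if c y != c x then N (A' :\ x :\ y) else 0.
have F_ge0 x y : 0 <= F x y by rewrite /F; case: ifP.
have FC x y : F x y = F y x by rewrite /F eq_sym setD1C.
have F_sum x : x \in A' -> \sum_(y in A') F x y = N A'.
  by move=> xA'; rewrite (N_rec xA') -big_mkcondr/=; apply: eq_bigl => y;
     rewrite !inE; case: (y =P x) => [->|]//; rewrite eqxx !andbF.
pose al x : R := (c x == c u)%:R; pose be x : R := (c x == c v)%:R.
(* Expand [N A] at [u] and then at [v]. The dropped terms, where [u] is matched to [v] or where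
   their partners share a colour, are nonnegative. *)
have lower : \sum_(x in A') \sum_(y in A') (1 - al x) * (1 - be y) * F x y <= N A.
  rewrite (N_rec uA).
  have -> : \sum_(x in A') \sum_(y in A') (1 - al x) * (1 - be y) * F x y =
     \sum_(x in A' | c x != c u) \sum_(y in A' | c y != c v) F x y.
    rewrite [RHS]big_mkcondr /=; apply: eq_bigr => x _.
    rewrite /al; case: eqP => _ /=.
      by rewrite big1// => y _; rewrite subrr !mul0r.
    rewrite [RHS]big_mkcondr /=; apply: eq_bigr => y _.
    by rewrite /be; case: eqP => _ /=; rewrite ?subrr ?subr0 ?mul1r ?mul0r.
  apply: (@le_trans _ _ (\sum_(x in A' | c x != c u) N (A :\ u :\ x))); last first.
    rewrite [leRHS](bigID (fun x => x != v)) /= -[leLHS]addr0 lerD ?sumr_ge0//.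
    rewrite le_eqVlt; apply/orP; left; apply/eqP/eq_bigl => x; rewrite !inE.
    case: (x =P u) => [->|_]; first by rewrite eqxx !andbF.
    by case: (x =P v) => //= _; rewrite ?andbF ?andbT.
  apply: ler_sum => x /andP[xA' cxu].
  have vx : v \in A :\ u :\ x.
    by move: xA'; rewrite !inE vA (eq_sym v u) uv (eq_sym v x) /= => /andP[->].
  rewrite (N_rec vx) [leRHS](bigID (fun y => c y != c x)) /= -[leLHS]addr0 lerD ?sumr_ge0//.
  rewrite le_eqVlt; apply/orP; left; apply/eqP.
  rewrite (bigID (fun y => c y != c x)) /= [X in _ + X]big1 ?addr0; last first.
    by move=> y /andP[_]; rewrite /F => /negbTE ->.
  apply: eq_big => y; last first.
    by move=> /andP[_]; rewrite /F => ->; rewrite /A' (setD1C (A :\ u)).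
  rewrite !inE; case: (y =P v) => [->|_]; first by rewrite !eqxx ?andbF.
  by case: (y =P x) => [->|_]; rewrite ?eqxx ?andbF.
apply: le_trans lower.
apply: (@le_trans _ _
    (\sum_(x in A') \sum_(y in A') (1 - al x - be y) * F x y)); last first.
  apply: ler_sum => x _; apply: ler_sum => y _; apply: ler_wpM2r => //.
  have : 0 <= al x * be y by rewrite mulr_ge0.
  by lra.
(* Each linear weight depends on one end of [xy] only, so the other end sums out by [F_sum]. *)
have -> : \sum_(x in A') \sum_(y in A') (1 - al x - be y) * F x y =
    (\sum_(x in A') (1 - al x - be x)) * N A'.
  rewrite (eq_bigr (fun x => (1 - al x) * N A' - \sum_(y in A') be y * F x y)).
    rewrite sumrB exchange_big /= mulr_suml.
    rewrite -sumrB; apply: eq_bigr => x xA'.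
    rewrite (eq_bigr (fun y => be x * F x y)) => [|y _]; last by rewrite FC.
    by rewrite -mulr_sumr F_sum// -mulrBl.
  move=> x xA'; rewrite -(F_sum x xA') mulr_sumr -sumrB.
  by apply: eq_bigr => y _; rewrite -mulrBl.
rewrite ler_wpM2r// -sum1_card natr_sum big_mkcond /= [leRHS]big_mkcond /=.
apply: ler_sum => x _; rewrite !inE /al /be.
have [->|xu] := eqVneq x u; first by rewrite eqxx !andbF.
have [->|xv] := eqVneq x v; first by rewrite eqxx !andbF.
case: (x \in A) => //=.
have [xu'|] := eqVneq (c x) (c u); first by rewrite xu' (negbTE cuv) /= mulr1n mulr0n; lra.
by move=> _; case: (eqVneq (c x) (c v)) => _ /=; rewrite ?mulr1n ?mulr0n; lra.
Qed.

(* Passing from [B] to [B - w1 - w2] changes neither [o] nor [b1 - b2], so the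
   induction only has to follow [b2]. *)
Lemma count_balance n B w1 w2 : #|[set z in B | c z == c w2]| = n ->
  w1 \in B -> w2 \in B -> c w1 != c w2 ->
  let b1 := #|[set z in B | c z == c w1]|%:R in
  let b2 := #|[set z in B | c z == c w2]|%:R in
  let o := #|[set z in B | (c z != c w1) && (c z != c w2)]|%:R in
  b2 <= b1 -> b2 <= o ->
  N (B :\ w2) <= N (B :\ w1) /\
  (o - b2) * (N (B :\ w1) - N (B :\ w2)) <= (b1 - b2) * N (B :\ w1).
Proof.
elim: n B w1 w2 => [|n IHn] B w1 w2.
  move=> /eqP; rewrite cards_eq0 => /eqP B0 _ w2B.
  by have := finset.in_set0 w2; rewrite -B0 inE w2B eqxx.
move=> Bn w1B w2B cw b1 b2 o b21 b2o.
have w12 : w1 != w2 by apply: contraNneq cw => ->.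
set C := B :\ w1 :\ w2.
have C1 : #|[set z in C | c z == c w1]|%:R = b1 - 1.
  rewrite /b1 (cardsD1 w1 [set z in B | _]) inE w1B eqxx /= natrD addrC addKr.
  congr _%:R; apply: eq_card => z; rewrite !inE.
  by case: (z =P w2) => [->|_]; rewrite ?(eq_sym (c w2)) ?(negbTE cw) ?andbF //= andbA.
have C2' : #|[set z in C | c z == c w2]| = n.
  move: Bn; rewrite (cardsD1 w2 [set z in B | _]) inE w2B eqxx /= => -[<-].
  apply: eq_card => z; rewrite !inE.
  by case: (z =P w1) => [->|_]; rewrite ?(negbTE cw) ?andbF //= andbA.
have C2 : #|[set z in C | c z == c w2]|%:R = b2 - 1.
  by rewrite C2' /b2 Bn -addn1 natrD addrK.
have Co : #|[set z in C | (c z != c w1) && (c z != c w2)]|%:R = o.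
  congr _%:R; apply: eq_card => z; rewrite !inE.
  case: (z =P w1) => [->|_]; first by rewrite eqxx !andbF.
  by case: (z =P w2) => [->|_]; rewrite ?eqxx ?andbF.
have := count_exchange w1B w2B w12; rewrite -/C => exch.
(* If the class of [w1] is used up, then [b1 = b2 = 1] and the exchange identity gives equality. *)
have [C1_0|[y1 y1C]] := set_0Vmem [set z in C | c z == c w1].
  have b1E : b1 = 1 by move: C1; rewrite C1_0 cards0; lra.
  have b2E : b2 = 1.
    have := ler0n R n; move: C2; rewrite C2' => ->; lra.
  move: exch; rewrite !big_pred0 ?addr0.
  - by move=> ->; rewrite b1E b2E !subrr mulr0 mul0r.
  - by move=> z; have := finset.in_set0 z; rewrite -C1_0 inE.
  - move=> z; have /eqP : n = 0%N.
      by apply/eqP; rewrite -(eqr_nat R) -C2' C2 b2E subrr.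
    by rewrite -C2' cards_eq0 => /eqP C2_0; have := finset.in_set0 z; rewrite -C2_0 inE.
move: y1C; rewrite inE => /andP[y1C /eqP cy1].
have avoid : o * N (C :\ y1) <= N (B :\ w1).
  have y1B : y1 \in B :\ w1 by move: y1C; rewrite !inE => /andP[].
  have w2B1 : w2 \in B :\ w1 by rewrite !inE eq_sym w12.
  have := @count_avoid (B :\ w1) w2 y1 w2B1 y1B; rewrite cy1 eq_sym => /(_ cw).
  congr (_%:R * _ <= _); apply: eq_card => z; rewrite !inE.
  by case: (z =P w1) => [->|_]; rewrite ?eqxx ?andbF //= [X in _ && X]andbC.
have sum1 : \sum_(z in C | c z == c w1) N (C :\ z) = (b1 - 1) * N (C :\ y1).
  by rewrite -C1 -cy1 sum_count_colour.
have [C2_0|[y2 y2C]] := set_0Vmem [set z in C | c z == c w2].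
  have b2E : b2 = 1 by move: C2; rewrite C2_0 cards0; lra.
  move: exch; rewrite sum1 big_pred0 ?addr0; last first.
    by move=> z; have := finset.in_set0 z; rewrite -C2_0 inE.
  have := N_ge0 (C :\ y1).
  move: (N (B :\ w1)) (N (B :\ w2)) (N (C :\ y1)) avoid => X Y f.
  move=> avoid f0 XY; split; first by nra.
  by rewrite b2E in b21 b2o *; nra.
move: y2C; rewrite inE => /andP[y2C /eqP cy2].
have sum2 : \sum_(z in C | c z == c w2) N (C :\ z) = (b2 - 1) * N (C :\ y2).
  by rewrite -C2 -cy2 sum_count_colour.
have := IHn C y1 y2; rewrite cy1 cy2 => /(_ C2' y1C y2C cw) /=.
rewrite C1 C2 Co => -[||le12 close]; [lra|lra|].
move: exch; rewrite sum1 sum2 => exch.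
have b2_ge1 : 1 <= b2 by rewrite /b2 Bn ler1n.
have := N_ge0 (C :\ y1).
clear C1 C2 C2' Co sum1 sum2 Bn; clearbody b1 b2 o.
move: (N (B :\ w1)) (N (B :\ w2)) (N (C :\ y1)) (N (C :\ y2)) avoid exch le12 close.
move=> X Y f g avoid exch fg close f0.
(* The difference splits into a part caused by the imbalance and a smaller copy of the same problem.
   Induction bounds [(o - b2 + 1) (f - g)] by [(b1 - b2) f], so [(o - b2) (X - Y)] is at most
   [(b1 - b2) (o - 1) f], and [o f <= X] concludes. *)
have D : X - Y = (b1 - b2) * f + (b2 - 1) * (f - g) by lra.
split; first by rewrite -subr_ge0 D; apply: addr_ge0; apply: mulr_ge0; lra.
have h1 : (b2 - 1) * ((o - (b2 - 1)) * (f - g)) <= (b2 - 1) * ((b1 - b2) * f).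
  apply: ler_wpM2l; first lra.
  by apply: le_trans close _; lra.
have h2 : (b1 - b2) * (o * f) <= (b1 - b2) * X by apply: ler_wpM2l => //; lra.
have h3 : 0 <= (b2 - 1) * (f - g) by apply: mulr_ge0; lra.
rewrite D; nra.
Qed.

(* [S P Q] counts pairs (matching, oriented edge from [P] to [Q]).  As the vertices
   outside the classes of [u] and [v] span no edge, [S cu cv] is determined by the
   class sizes. *)
Lemma count_two_colour_classes A u v : u \in A -> v \in A -> c u != c v ->
  let a := #|[set z in A | c z == c u]|%:R in
  let b := #|[set z in A | c z == c v]|%:R in
  let o := #|[set z in A | (c z != c u) && (c z != c v)]|%:R in
  (forall z z', z \in A -> z' \in A -> c z != c u -> c z != c v ->
     c z' != c u -> c z' != c v -> c z = c z') ->
  2 * a * b * N (A :\ u :\ v) = (a + b - o) * N A.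
Proof.
move=> uA vA cuv a b o mono.
pose F x y := if c y != c x then N (A :\ x :\ y) else 0.
have FC x y : F x y = F y x by rewrite /F eq_sym setD1C.
pose S (P Q : pred V) := \sum_(x in A | P x) \sum_(y in A | Q y) F x y.
have SC P Q : S P Q = S Q P.
  rewrite /S exchange_big /=; apply: eq_bigr => x _; apply: eq_bigr => y _.
  exact: FC.
pose cu z := c z == c u; pose cv z := c z == c v.
pose co z := (c z != c u) && (c z != c v).
have S3 P : S P cu + S P cv + S P co = #|[set z in A | P z]|%:R * N A.
  rewrite /S -!big_split /= -sum1_card natr_sum mulr_suml.
  apply: eq_big => [x|x /andP[xA _]]; first by rewrite inE.
  rewrite mul1r (N_rec xA).
  transitivity (\sum_(y in A) F x y).
    rewrite [RHS](bigID cu) /= -addrA; congr (_ + _).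
    rewrite [RHS](bigID cv) /=; congr (_ + _); apply: eq_bigl => y; last by rewrite andbA.
    rewrite /cu /cv; case: (c y =P c v) => [->|]; last by rewrite !andbF.
    by rewrite eq_sym cuv !andbT.
  by rewrite -big_mkcondr.
have S0 (P : pred V) : (forall x y, x \in A -> y \in A -> P x -> P y -> c x = c y) -> S P P = 0.
  move=> h; rewrite /S big1// => x /andP[xA Px]; rewrite big1// => y /andP[yA Py].
  by rewrite /F (h y x)// eqxx.
have Suu : S cu cu = 0 by apply: S0 => x y _ _ /eqP -> /eqP ->.
have Svv : S cv cv = 0 by apply: S0 => x y _ _ /eqP -> /eqP ->.
have Soo : S co co = 0.
  by apply: S0 => x y xA yA /andP[? ?] /andP[? ?]; exact: mono.
(* By [count_same_colour], applied once in each class, every pair contributes [N (A :\ u :\ v)]. *)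
have Suv : S cu cv = a * b * N (A :\ u :\ v).
  rewrite /S (eq_bigr (fun=> b * N (A :\ u :\ v))).
    rewrite -mulrA {1}/a -sum1_card natr_sum mulr_suml.
    by apply: eq_big => [x|x _]; rewrite ?inE ?mul1r.
  move=> x /andP[xA /eqP cx].
  rewrite /b -sum1_card natr_sum mulr_suml.
  apply: eq_big => [y|y /andP[yA /eqP cy]]; first by rewrite inE.
  rewrite mul1r /F cx cy eq_sym cuv.
  have xy : x != y by apply: contraNneq cuv => xy; rewrite -cx xy cy.
  have xv : x != v by apply: contraNneq cuv => xv; rewrite -cx xv.
  have uv : u != v by apply: contraNneq cuv => ->.
  rewrite (@count_same_colour (A :\ x) y v) ?inE ?yA ?vA ?andbT ?(eq_sym _ x) //.
  by rewrite setD1C (@count_same_colour (A :\ v) x u) ?inE ?xv ?uv// setD1C.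
(* The equations read [S cu cv + S cu co = a N A], [S cu cv + S cv co = b N A] and
   [S cu co + S cv co = o N A]; the first two minus the third give the claim. *)
have := S3 cu; have := S3 cv; have := S3 co.
rewrite -/a -/b -/o Suu Svv Soo Suv (SC cv cu) (SC cv co) (SC co cu) Suv.
by move: (S cu co) (S co cv) (N _) => X Y Z; lra.
Qed.

End MatchingCounts.

(** * Equal colour classes *)

Section RealEstimates.
Context (R : realFieldType).
Implicit Types (r m n a b o K X Y Z g : R).

(** Here [a], [b], [o] stand for the sizes in [A] of the class of [u], of the class of [v] and of
    the rest, [X] for [N A], [g] for [N (A :\ u :\ v)] and [K] for the number of deleted vertices.
    When [(r - 1) m (a + b - o) - 2 a b] is expanded in the deficits, the coefficient of [m ^ 2] is
    [- (r - 2) (r - 3)], which vanishes, so the error has order [K m]. *)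
Lemma few_colours_estimate r m n a b o K X g :
  0 <= K -> 0 <= X -> 8 * (K + 1) <= n -> r * m = 2 * n -> r = 2 \/ r = 3 ->
  a <= m -> m - K <= a -> b <= m -> m - K <= b ->
  o <= (r - 2) * m -> (r - 2) * m - K <= o ->
  2 * a * b * g = (a + b - o) * X ->
  n * `|(r - 1) * m * g - X| <= 18 * K * X.
Proof.
move=> K0 X0 nK rm r23 ale age ble bge ole oge key.
have m_ge : 2 * n <= 3 * m by case: r23 => rE; rewrite rE in rm; lra.
(* The size hypothesis gives [m >= 16/3 (K + 1)], so four fifths of each class survive; this
   suffices for [m ^ 2 <= 2 a b]. *)
have mK : 4 * m <= 5 * a /\ 4 * m <= 5 * b by split; lra.
have ab : m * m <= 2 * (a * b).
  have : (4 / 5 * m) * (4 / 5 * m) <= a * b by apply: ler_pM; lra.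
  by have := @mulr_ge0 _ m m; lra.
set al := m - a; set be := m - b; set ga := (r - 2) * m - o.
have E : 2 * (a * b) * ((r - 1) * m * g - X) =
  ((3 - r) * m * (al + be) + (r - 1) * m * ga - 2 * (al * be)) * X.
  transitivity ((r - 1) * m * (2 * a * b * g) - 2 * (a * b) * X); first by ring.
  by rewrite key /al /be /ga; case: r23 => ->; ring.
have alK : 0 <= al <= K by rewrite /al; lra.
have beK : 0 <= be <= K by rewrite /be; lra.
have gaK : 0 <= ga <= K by rewrite /ga; lra.
have bnd : `|(3 - r) * m * (al + be) + (r - 1) * m * ga - 2 * (al * be)| <= 3 * (m * K).
  have h1 : 0 <= al * be <= m * K.
    by rewrite mulr_ge0 /= ?ler_pM//; lra.
  have h2 : 0 <= m * ga <= m * K.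
    by rewrite mulr_ge0 /= ?ler_wpM2l//; lra.
  have h3 : 0 <= m * (al + be) <= m * (2 * K).
    by rewrite mulr_ge0 /= ?ler_wpM2l//; lra.
  by rewrite ler_norml; case: r23 => ->; lra.
have : m * m * `|(r - 1) * m * g - X| <= 3 * (m * K) * X.
  apply: (@le_trans _ _ (2 * (a * b) * `|(r - 1) * m * g - X|)).
    by apply: ler_wpM2r.
  have ab0 : 0 <= 2 * (a * b) by have := @mulr_ge0 _ m m; lra.
  rewrite -{1}(ger0_norm ab0) -normrM E normrM (ger0_norm X0).
  exact: ler_wpM2r.
have m_gt0 : 0 < m by lra.
move: `|_| (normr_ge0 ((r - 1) * m * g - X)) => Y Y0 mmY.
have mY : m * Y <= 3 * (K * X) by rewrite -(ler_pM2l m_gt0); lra.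
have nY : n * Y <= 3 / 2 * m * Y by apply: ler_wpM2r => //; lra.
by have := mulr_ge0 K0 X0; lra.
Qed.

End RealEstimates.

(** * Deleting an edge from a nearly balanced vertex set *)

Section EquipartiteCounts.
Context (R : realFieldType) (V J : finType) (c : V -> J) (m : nat).
Context (card_class : forall i, #|[set z | c z == i]| = m).
Implicit Types (A : {set V}) (P : pred J).

Lemma card_colours P : #|[set z | P (c z)]| = (#|P| * m)%N.
Proof.
rewrite -sum1_card (partition_big c P) /=; last by move=> z; rewrite inE.
rewrite (eq_bigr (fun=> m)) ?sum_nat_const// => i Pi.
rewrite -[RHS](card_class i) -sum1_card; apply: eq_bigl => z.
by rewrite !inE; case: eqP => [->|]; rewrite ?Pi ?andbF.
Qed.

Lemma card_colours_in P A :
  (#|[set z in A | P (c z)]| <= #|P| * m)%N /\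
  (#|P| * m <= #|[set z in A | P (c z)]| + #|~: A|)%N.
Proof.
rewrite -card_colours; split.
  by apply: subset_leq_card; apply/fintype.subsetP => z; rewrite !inE => /andP[].
rewrite (leq_trans _ (leq_card_setU _ _))//; apply: subset_leq_card.
by apply/fintype.subsetP => z; rewrite !inE => ->; case: (z \in A).
Qed.

Lemma card_colours_other_than2 (i j : J) : i != j ->
  (#|[pred k | (k != i) && (k != j)]| + 2)%N = #|J|.
Proof.
move=> ij; rewrite (cardD1 i J) (cardD1 j [predD1 J & i]) !inE eq_sym ij /=.
rewrite addnA addnC; congr (_ + _)%N.
by apply: eq_card => k; rewrite !inE andbT andbC.
Qed.

Context (N : {set V} -> R) (N_ge0 : forall A, 0 <= N A).
Context (N_rec : forall (A : {set V}) u, u \in A ->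
  N A = \sum_(v in A | c v != c u) N (A :\ u :\ v)).
Context (n : nat) (n_def : (#|J| * m = 2 * n)%N) (J_gt1 : (1 < #|J|)%N).

Lemma class_size (A : {set V}) i :
  #|[set z in A | c z == i]|%:R <= m%:R :> R /\
  m%:R - #|~: A|%:R <= #|[set z in A | c z == i]|%:R :> R.
Proof.
have [] := card_colours_in (pred1 i) A; rewrite card1 mul1n => h1 h2.
by split; rewrite ?lerBlDr -?natrD ler_nat.
Qed.

Lemma other_classes_size (A : {set V}) i j : i != j ->
  let o := #|[set z in A | (c z != i) && (c z != j)]| in
  o%:R <= (#|J|%:R - 2) * m%:R :> R /\
  (#|J|%:R - 2) * m%:R - #|~: A|%:R <= o%:R :> R.
Proof.
move=> ij o.
have [] := card_colours_in [pred k | (k != i) && (k != j)] A.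
rewrite -/o -(card_colours_other_than2 ij) natrD addrK => h1 h2.
by split; rewrite ?lerBlDr -?natrM -?natrD ler_nat.
Qed.

(** Besides the colours of [u] and [v] at most one remains, so the other vertices of [A] span no
    edge and the exact formula applies. *)
Lemma count_few_colours (A : {set V}) u v : (#|J| <= 3)%N ->
  u \in A -> v \in A -> c u != c v -> (8 * (#|~: A| + 1) <= n)%N ->
  n%:R * `|(#|J|%:R - 1) * m%:R * N (A :\ u :\ v) - N A| <= 18 * #|~: A|%:R * N A.
Proof.
move=> J3 uA vA cuv n_large.
have := count_two_colour_classes N_rec uA vA cuv.
have [ale age] := class_size A (c u); have [ble bge] := class_size A (c v).
have [ole oge] := other_classes_size A cuv.
have mono z z' : z \in A -> z' \in A -> c z != c u -> c z != c v ->
    c z' != c u -> c z' != c v -> c z = c z'.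
  move=> _ _ zu zv z'u z'v; apply/eqP; apply: contraTT J3 => zz'.
  rewrite -ltnNge (leq_trans _ (max_card (mem [:: c u; c v; c z; c z'])))//.
  rewrite (card_uniqP _)//= !inE !negb_or cuv (eq_sym (c u)) zu (eq_sym (c u)) z'u.
  by rewrite (eq_sym (c v)) zv (eq_sym (c v)) z'v zz'.
move=> /(_ mono) {mono}.
have K0 : 0 <= #|~: A|%:R :> R by [].
have nK : 8 * (#|~: A|%:R + 1) <= n%:R :> R.
  by move: n_large; rewrite -(ler_nat R) natrM natrD.
have rm : #|J|%:R * m%:R = 2 * n%:R :> R by rewrite -!natrM n_def.
have r23 : #|J|%:R = 2 :> R \/ #|J|%:R = 3 :> R.
  by case: #|J| J_gt1 J3 => [|[|[|[|]]]]//; [left|right].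
exact: few_colours_estimate.
Qed.

(** [N A] is the sum of [g x = N (A :\ u :\ x)] over the neighbours [x] of [u], and these summands
    are nearly equal. The constant is [18 = 2 + 16]: replacing the degree of [u] in [A] by the full
    degree costs [2 K N A], replacing every [g x] by [g v] costs [16 K N A]. *)
Lemma count_many_colours (A : {set V}) u v : (3 < #|J|)%N ->
  u \in A -> v \in A -> c u != c v -> (8 * (#|~: A| + 1) <= n)%N ->
  n%:R * `|(#|J|%:R - 1) * m%:R * N (A :\ u :\ v) - N A| <= 18 * #|~: A|%:R * N A.
Proof.
move=> J4 uA vA cuv n_large.
have nK : 8 * (#|~: A|%:R + 1) <= n%:R :> R.
  by move: n_large; rewrite -(ler_nat R) natrM natrD.
have K0 : 0 <= #|~: A|%:R :> R by [].
set K := #|~: A|%:R in nK K0 *.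
have rm : #|J|%:R * m%:R = 2 * n%:R :> R by rewrite -!natrM n_def.
have r4 : 4 * m%:R <= #|J|%:R * m%:R :> R by rewrite -!natrM ler_nat leq_mul2r J4 orbT.
have n0 : 0 < n%:R :> R by lra.
pose g x := N (A :\ u :\ x).
have g_small x : x \in A -> c u != c x -> n%:R * g x <= 2 * N A.
  move=> xA cux; have := count_avoid N_ge0 N_rec uA xA cux.
  have [_] := other_classes_size A cux; rewrite -/K -/(g x) => oge og.
  (* With at least four classes [(#|J| - 2) m >= n], so at least [n - K >= n / 2] vertices avoid
     both colours. *)
  have : n%:R / 2 * g x <= N A.
    by apply: le_trans og; apply: ler_wpM2r; [exact: N_ge0|lra].
  by lra.
have g_close x y : x \in A -> y \in A -> c u != c x -> c u != c y ->
    n%:R * (n%:R * `|g x - g y|) <= 8 * K * N A.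
  (* [count_balance] wants the smaller class second. *)
  wlog xy : x y / #|[set z in A :\ u | c z == c y]|%:R <=
                  #|[set z in A :\ u | c z == c x]|%:R :> R.
    move=> th xA yA cux cuy; case/orP: (le_total #|[set z in A :\ u | c z == c y]|%:R
      (#|[set z in A :\ u | c z == c x]|%:R : R)) => xy; first exact: th.
    by rewrite distrC; exact: th.
  move=> xA yA cux cuy.
  have xB : x \in A :\ u by rewrite !inE xA andbT; apply: contraNneq cux => ->.
  have yB : y \in A :\ u by rewrite !inE yA andbT; apply: contraNneq cuy => ->.
  have [cxy|cxy] := eqVneq (c x) (c y).
    rewrite /g (count_same_colour N_rec xB yB cxy) subrr normr0 !mulr0.
    by rewrite !mulr_ge0.
  have [_] := other_classes_size (A :\ u) cxy.
  have sameA w : c u != c w -> [set z in A :\ u | c z == c w] = [set z in A | c z == c w].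
    move=> cuw; apply/setP => z; rewrite !inE; case: (z =P u) => [->|//].
    by rewrite (negbTE cuw) !andbF.
  have := count_balance N_ge0 N_rec erefl xB yB cxy.
  rewrite /= !sameA// in xy *.
  have [ale age] := class_size A (c x); have [ble bge] := class_size A (c y).
  have -> : #|~: (A :\ u)|%:R = K + 1.
    by rewrite natr1 finset.setCD finset.setUC cardsU1 !inE uA add1n.
  move=> bal oge; have [|le_g close] := bal xy; first by rewrite -/K in bge age oge; lra.
  have gx := g_small x xA cux.
  rewrite -/(g x) -/(g y) -/K in le_g close age bge.
  rewrite ger0_norm ?subr_ge0//.
  have gx0 : 0 <= g x by exact: N_ge0.
  (* The two classes differ by at most [K], and [o - b2 >= (#|J| - 3) m - (K + 1) >= n / 4], because
     [(#|J| - 3) m >= n / 2]. *)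
  have : n%:R / 4 * (g x - g y) <= K * g x.
    apply: (le_trans _ (le_trans close _)).
      by apply: ler_wpM2r; lra.
    by apply: ler_wpM2r; lra.
  move=> h; have := ler_wpM2l (ltW n0) h.
  by have := ler_wpM2l K0 gx; lra.
have NA : N A = \sum_(x in A | c x != c u) g x by exact: N_rec.
pose d : R := #|[set x in A | c x != c u]|%:R.
have [dle dge] : d <= (#|J|%:R - 1) * m%:R /\ (#|J|%:R - 1) * m%:R - K <= d.
  have [] := card_colours_in (predC1 (c u)) A; rewrite cardC1 => h1 h2.
  have -> : #|J|%:R - 1 = #|J|.-1%:R :> R.
    by rewrite -[in LHS](prednK (ltnW J_gt1)) -natr1 addrK.
  by rewrite lerBlDr -natrM -natrD !ler_nat.
have d_sum (a : R) : \sum_(x in A | c x != c u) a = d * a.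
  rewrite /d -sum1_card natr_sum mulr_suml; apply: eq_big => [x|x _].
    by rewrite inE.
  by rewrite mul1r.
have sum_close : n%:R * \sum_(x in A | c x != c u) `|g v - g x| <= 16 * K * N A.
  rewrite -(ler_pM2l n0) !mulr_sumr.
  apply: (@le_trans _ _ (d * (8 * K * N A))).
    rewrite -d_sum; apply: ler_sum => x /andP[xA cxu]; apply: g_close => //.
    by rewrite eq_sym.
  have : d <= 2 * n%:R by have : 0 <= m%:R :> R; [exact: ler0n|lra].
  have KN : 0 <= K * N A by rewrite mulr_ge0.
  by move/(ler_wpM2r KN); lra.
have gv := g_small v vA cuv; rewrite -/(g v).
have gv0 : 0 <= g v by exact: N_ge0.
have -> : (#|J|%:R - 1) * m%:R * g v - N A =
    ((#|J|%:R - 1) * m%:R - d) * g v + \sum_(x in A | c x != c u) (g v - g x).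
  by rewrite sumrB d_sum -NA; ring.
have : `|((#|J|%:R - 1) * m%:R - d) * g v + \sum_(x in A | c x != c u) (g v - g x)|
    <= K * g v + \sum_(x in A | c x != c u) `|g v - g x|.
  apply: le_trans (ler_normD _ _) _; apply: lerD; last exact: ler_norm_sum.
  by rewrite normrM (ger0_norm gv0) ler_wpM2r// ler_norml; lra.
move/(ler_wpM2l (ltW n0)).
by have := ler_wpM2l K0 gv; lra.
Qed.

(** Joins the two regimes into a bound uniform in the number of classes, which may vary with [n] in
    the application. *)
Lemma count_edge_estimate (A : {set V}) u v :
  u \in A -> v \in A -> c u != c v -> (8 * (#|~: A| + 1) <= n)%N ->
  n%:R * `|(#|J|%:R - 1) * m%:R * N (A :\ u :\ v) - N A| <= 18 * #|~: A|%:R * N A.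
Proof.
by case: (leqP #|J| 3) => J3; [exact: count_few_colours|exact: count_many_colours].
Qed.

End EquipartiteCounts.

(** * Matchings containing given edges *)

Section MatchingsOfSets.
Context (V : finType) (e : rel V).
Implicit Types (A E : {set V}) (S T M : {set {set V}}).

(** The graph stays fixed while the vertex set shrinks, as the recursion requires; for [A =
    [set: V]] the condition is [perfect_matching]. *)
Definition matchings_of A : {set {set {set V}}} :=
  [set T : {set {set V}} | (T \subset edges e) && finset.partition T A].

(** Deleting [E] is a bijection between the two families, with inverse adding [E]: a partition of
    [A :\: E] cannot contain the nonempty block [E]. *)
Lemma card_matchings_of_sup A E S : E \in S -> E \in edges e -> E != finset.set0 ->
  E \subset A ->
  #|[set T in matchings_of A | S \subset T]| =
  #|[set T in matchings_of (A :\: E) | S :\ E \subset T]|.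
Proof.
move=> ES Ee E0 EA.
have E_notin T : T \in matchings_of (A :\: E) -> E \notin T.
  rewrite inE => /andP[_ /finset.partitionS sT]; apply/negP => /sT.
  rewrite finset.subsetD => /andP[_]; rewrite -finset.setI_eq0 finset.setIid.
  by rewrite (negbTE E0).
rewrite -[RHS](card_in_imset (f := fun T => E |: T)) => [|T1 T2]; last first.
  move=> /finset.setIdP[T1m _] /finset.setIdP[T2m _] /= eT.
  have [ET1 ET2] := (E_notin _ T1m, E_notin _ T2m).
  by rewrite -(setU1K ET1) eT setU1K.
apply: eq_card => T; rewrite [in LHS]inE.
apply/andP/imsetP => [[Tm ST]|[T' T'm ->]].
  have ET : E \in T by exact: (fintype.subsetP ST).
  exists (T :\ E); last by rewrite finset.setD1K.
  rewrite !inE finset.setSD// andbT; move: Tm; rewrite inE => /andP[Te TA].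
  by rewrite finset.partitionD1// andbT (fintype.subset_trans _ Te)// subD1set.
move: T'm; rewrite !inE => /andP[/andP[T'e T'A] ST'].
split; last by rewrite -(finset.setD1K ES) finset.setUS.
rewrite finset.subUset finset.sub1set Ee T'e /=.
have := finset.partitionU1 T'A E0; rewrite -finset.setI_eq0 finset.setIDA.
rewrite (finset.setIidPl EA) finset.setDv => /(_ (eqxx _)).
suff -> : E :|: (A :\: E) = A by [].
apply/setP => z; rewrite !inE.
by case: (boolP (z \in E)) => //= /(fintype.subsetP EA) ->.
Qed.

End MatchingsOfSets.

Section MultipartiteMatchings.
Context (V : finType) (J : eqType) (c : V -> J).
Let e : rel V := fun u v => c u != c v.
Implicit Types (A E : {set V}) (S T M : {set {set V}}).

Lemma edgesP E : reflect (exists u v, c u != c v /\ E = [set u; v]) (E \in edges e).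
Proof.
rewrite inE; apply: (iffP existsP) => [[u /existsP[v /andP[uv /eqP ->]]]|[u [v [uv ->]]]].
  by exists u, v.
by exists u; apply/existsP; exists v; rewrite /e uv eqxx.
Qed.

(** Sort the matchings by the partner of [u], then delete the edge at [u]. This supplies the
    hypothesis [N_rec] of the abstract counts. *)
Lemma matchings_of_rec A u : u \in A ->
  #|matchings_of e A| = (\sum_(v in A | c v != c u) #|matchings_of e (A :\ u :\ v)|)%N.
Proof.
move=> uA.
rewrite -sum1_card (eq_bigr (fun T => \sum_(v in A | c v != c u)
   ([set u; v] \in T : nat))%N) => [|T]; last first.
  rewrite inE => /andP[Te TA].
  have uT : finset.pblock T u \in T by rewrite finset.pblock_mem ?(finset.cover_partition TA).
  have [w wA [cuw uwE]] : exists2 w, w \in A & c w != c u /\ finset.pblock T u = [set u; w].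
    have : u \in finset.pblock T u by rewrite finset.mem_pblock (finset.cover_partition TA).
    have := fintype.subsetP (finset.partitionS TA uT).
    have /(edgesP)[x [y [cxy ->]]] := fintype.subsetP Te _ uT.
    move=> sA; rewrite !inE => /orP[]/eqP ->.
      by exists y; [rewrite sA// !inE eqxx orbT|rewrite eq_sym].
    by exists x; [rewrite sA// !inE eqxx|rewrite finset.setUC].
  rewrite (bigD1 w) ?wA //= -uwE uT big1 ?addn0// => v /andP[/andP[vA cuv] vw].
  apply/eqP; rewrite eqb0; apply: contraNN vw => uvT.
  have := finset.def_pblock (finset.partition_trivIset TA) uvT (finset.set21 u v).
  rewrite uwE => /setP/(_ v); rewrite !inE eqxx orbT.
  by case: eqP => //= vu; rewrite vu eqxx in cuv.
rewrite exchange_big /=; apply: eq_bigr => v /andP[vA cuv].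
have Ee : [set u; v] \in edges e by apply/edgesP; exists u, v; rewrite eq_sym.
have E0 : [set u; v] != finset.set0 by apply/set0Pn; exists u; rewrite finset.set21.
have EA : [set u; v] \subset A.
  by apply/fintype.subsetP => z; rewrite !inE => /orP[]/eqP ->.
have := card_matchings_of_sup (set11 [set u; v]) Ee E0 EA.
rewrite finset.setDv finset.setDDl => supE.
transitivity #|[set T in matchings_of e A | [set [set u; v]] \subset T]|.
  rewrite -[RHS]sum1_card [RHS]big_mkcond /= [LHS]big_mkcond; apply: eq_bigr => T _.
  by rewrite [in RHS]inE finset.sub1set; case: (T \in _).
by rewrite supE; apply: eq_card => T; rewrite [in LHS]inE finset.sub0set andbT.
Qed.

End MultipartiteMatchings.

(** * Matchings containing several prescribed edges *)

Section EquipartiteMatchings.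
Context (R : realFieldType) (V J : finType) (c : V -> J) (m n : nat).
Context (card_class : forall i, #|[set z | c z == i]| = m).
Context (n_def : (#|J| * m = 2 * n)%N) (J_gt1 : (1 < #|J|)%N).
Let e : rel V := fun u v => c u != c v.
Let N A : R := #|matchings_of e A|%:R.
Let L : R := (#|J|%:R - 1) * m%:R.

(** The edges of [S] are deleted one by one, and [K] bounds the number of deleted vertices
    throughout. As [18 K <= n] gives [L N (A :\: E) <= 2 N A], each step doubles the error and adds
    [18 K], whence [18 K (2 ^ k - 1)]. The matching [M] around [S] ensures that the remaining edges
    still lie in the shrunken vertex set. *)
Lemma matchings_of_sup_estimate k K (A : {set V}) (M S : {set {set V}}) :
  M \in matchings_of e A -> S \subset M -> #|S| = k ->
  (#|~: A| + 2 * k <= K)%N -> (8 * (K + 1) <= n)%N -> (18 * K <= n)%N ->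
  n%:R * `|L ^+ k * #|[set T in matchings_of e A | S \subset T]|%:R - N A|
    <= 18 * K%:R * (2 ^+ k - 1) * N A.
Proof.
elim: k A M S => [|k IHk] A M S MA SM cS AK n1 n2.
  have /eqP -> : S == finset.set0 by rewrite -cards_eq0 cS.
  rewrite expr0 subrr mulr0 mul0r mul1r (_ : [set T in _ | _] = matchings_of e A).
    by rewrite subrr normr0 mulr0.
  by apply/setP => T; rewrite [LHS]inE finset.sub0set andbT.
have [E ES] : exists E, E \in S by apply/set0Pn; rewrite -card_gt0 cS.
have EM := fintype.subsetP SM _ ES.
have := MA; rewrite inE => /andP[Me MA'].
have Ee := fintype.subsetP Me _ EM.
have E0 := partition_neq0 MA' EM; have EA := finset.partitionS MA' EM.
have /edgesP[u [v [cuv Euv]]] := Ee.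
have uA : u \in A by rewrite (fintype.subsetP EA)// Euv finset.set21.
have vA : v \in A by rewrite (fintype.subsetP EA)// Euv finset.set22.
rewrite (card_matchings_of_sup ES Ee E0 EA).
have AE : A :\: E = A :\ u :\ v by rewrite finset.setDDl Euv.
have MAE : M :\ E \in matchings_of e (A :\: E).
  rewrite inE finset.partitionD1// andbT.
  by rewrite (fintype.subset_trans _ Me)// finset.subsetDl.
have cE : #|E| = 2%N by rewrite Euv cards2; suff -> : u != v by []; apply: contraNneq cuv => ->.
have cAE : #|~: (A :\: E)| = (#|~: A| + 2)%N.
  rewrite finset.setCD cardsU cE finset.setIC -finset.setDE.
  by have /eqP -> : E :\: A == finset.set0; rewrite ?finset.setD_eq0// cards0 subn0.
have /IHk IH := MAE.
have := IH _ (finset.setSD _ SM).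
have -> : #|S :\ E| = k by move: cS; rewrite (cardsD1 E) ES => -[].
have AK' : (#|~: A| + 2 + 2 * k <= K)%N by move: AK; rewrite mulnS addnA.
have AleK : (#|~: A| <= K)%N by rewrite (leq_trans _ AK)// leq_addr.
rewrite cAE => /(_ erefl AK' n1 n2) {}IH.
have est : n%:R * `|L * N (A :\: E) - N A| <= 18 * K%:R * N A.
  apply: (@le_trans _ _ (18 * #|~: A|%:R * N A)); last first.
    by rewrite ler_wpM2r// ler_wpM2l// ler_nat.
  rewrite AE; apply: (count_edge_estimate (N := N) card_class) => //; last first.
    by rewrite (leq_trans _ n1)// leq_mul2l leq_add2r.
  by move=> B w wB; rewrite /N (matchings_of_rec c wB) natr_sum.
have L0 : 0 <= L by rewrite mulr_ge0// subr_ge0 ler1n ltnW.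
have NA0 : 0 <= N A by [].
have K0 : 0 <= K%:R :> R by [].
have n0 : 0 < n%:R :> R by rewrite ltr0n (leq_trans _ n1)// muln_gt0 addn_gt0 orbT.
have Kn : 18 * K%:R <= n%:R :> R by rewrite -natrM ler_nat.
have p1 : 1 <= 2 ^+ k :> R by rewrite exprn_ege1// ler1n.
move: #|[set T in _ | _]|%:R IH est => X IH est.
have LN : L * N (A :\: E) <= 2 * N A.
  have : n%:R * `|L * N (A :\: E) - N A| <= n%:R * N A.
    by apply: le_trans est _; apply: ler_wpM2r.
  by rewrite (ler_pM2l n0) ler_norml; lra.
have -> : L ^+ k.+1 * X - N A =
    L * (L ^+ k * X - N (A :\: E)) + (L * N (A :\: E) - N A).
  by rewrite exprS; ring.
apply: le_trans (_ : L * (n%:R * `|L ^+ k * X - N (A :\: E)|) +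
    n%:R * `|L * N (A :\: E) - N A| <= _).
  rewrite mulrCA -mulrDr ler_wpM2l//.
  by apply: le_trans (ler_normD _ _) _; rewrite normrM (ger0_norm L0).
apply: (@le_trans _ _ (18 * K%:R * (2 ^+ k - 1) * (2 * N A) + 18 * K%:R * N A)).
  apply: lerD => //; apply: (le_trans (ler_wpM2l L0 IH)).
  rewrite mulrCA ler_wpM2l// !mulr_ge0//; lra.
by rewrite exprS; lra.
Qed.

End EquipartiteMatchings.

(** * Factorial moments and probabilities *)

(** For [i <= y], both sides become [(k + y)!] when multiplied by [k! i! (y - i)!]. *)
Lemma bin_trinomial k i y :
  ('C(k + i, k) * 'C(k + y, k + i) = 'C(k + y, k) * 'C(y, i))%N.
Proof.
have [yi|iy] := ltnP y i; first by rewrite (bin_small yi) (@bin_small (k + y)) ?ltn_add2l// !muln0.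
have h1 := bin_fact (leq_addr i k); have h2 := bin_fact (leq_addr y k).
have h3 := bin_fact iy; have := @bin_fact (k + y) (k + i); rewrite leq_add2l => /(_ iy).
rewrite subnDl !addKn in h1 h2 * => h4.
have f0 : (0 < k`! * (i`! * (y - i)`!))%N by rewrite !muln_gt0 !fact_gt0.
apply/eqP; rewrite -(eqn_pmul2r f0); apply/eqP.
transitivity ((k + y)`!); last by rewrite -h2 -h3; ring.
by rewrite -h4 -h1; ring.
Qed.

Section Bonferroni.
Context (R : realFieldType).

Lemma sum_signed_bin y I :
  \sum_(i < I.+1) (-1) ^+ i * 'C(y.+1, i)%:R = (-1) ^+ I * 'C(y, I)%:R :> R.
Proof.
elim: I => [|I IHI]; first by rewrite big_ord1 !bin0.
by rewrite big_ord_recr /= IHI binS natrD exprS; ring.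
Qed.

Lemma sum_signed_bin_bound y I :
  `|(y == 0%N)%:R - \sum_(i < I) (-1) ^+ i * 'C(y, i)%:R| <= 'C(y, I)%:R :> R.
Proof.
case: y I => [|y] [|I]; rewrite ?big_ord0 ?subr0 ?normr0 ?normr1//.
  rewrite big_ord_recl big1 => [|i _]; last by rewrite bin0n mulr0.
  by rewrite expr0 bin0 mul1r addr0 subrr normr0.
rewrite sum_signed_bin sub0r normrN normrM normrX normrN1 expr1n mul1r ger0_norm//.
by rewrite ler_nat binS leq_addl.
Qed.

(** For [x = k + y], trinomial revision extracts ['C(k + y, k)] from every term. What remains is
    truncated inclusion-exclusion for the event [y = 0], whose error is at most the first omitted
    term. *)
Lemma bonferroni x k I :
  `|(x == k)%:R - \sum_(i < I) (-1) ^+ i * 'C(k + i, k)%:R * 'C(x, k + i)%:R|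
    <= 'C(k + I, k)%:R * 'C(x, k + I)%:R :> R.
Proof.
have [xk|kx] := ltnP x k.
  rewrite ltn_eqF// big1 => [|i _]; last by rewrite (bin_small (ltn_addr i xk)) mulr0.
  by rewrite subr0 normr0 mulr_ge0.
rewrite -(subnKC kx) -[X in _ == X]addn0 eqn_add2l; move: (x - k)%N => y.
have bin_k i : 'C(k + i, k)%:R * 'C(k + y, k + i)%:R = 'C(k + y, k)%:R * 'C(y, i)%:R :> R.
  by rewrite -!natrM bin_trinomial.
rewrite bin_k.
have -> : (y == 0%N)%:R = 'C(k + y, k)%:R * (y == 0%N)%:R :> R.
  by case: y {bin_k} => [|y]; rewrite ?mulr0// addn0 binn mulr1.
under eq_bigr do rewrite -mulrA bin_k mulrCA.
by rewrite -mulr_sumr -mulrBr normrM ger0_norm// ler_wpM2l// sum_signed_bin_bound.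
Qed.

Lemma ffact_approx n k : (0 < n)%N ->
  `|(n ^_ k)%:R / n%:R ^+ k - 1| <= k%:R ^+ 2 / n%:R :> R.
Proof.
move=> n0; have n0' : 0 < n%:R :> R by rewrite ltr0n.
(* Cleared of denominators for the induction, which closes by [j ^ 2 + j <= (j + 1) ^ 2]. *)
have h k' : n%:R * (n%:R ^+ k' - (n ^_ k')%:R) <= k'%:R ^+ 2 * n%:R ^+ k' :> R
    /\ (n ^_ k')%:R <= n%:R ^+ k' :> R.
  elim: k' => [|j [IH1 IH2]]; first by rewrite ffactn0 expr0 subrr mulr0 expr0n mul0r.
  have f0 : 0 <= (n ^_ j)%:R :> R by [].
  have nj : (n - j)%:R <= n%:R :> R by rewrite ler_nat leq_subr.
  have nj' : n%:R - j%:R <= (n - j)%:R :> R by rewrite lerBlDr -natrD ler_nat; lia.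
  rewrite ffactnSr natrM; split; last by rewrite exprSr ler_pM.
  have a1 := ler_wpM2l (ltW n0') IH1.
  have a2 := ler_wpM2l f0 nj'.
  have a3 : j%:R * (n ^_ j)%:R <= j%:R * n%:R ^+ j :> R by rewrite ler_wpM2l.
  have a4 := ler_wpM2l (ltW n0') a3.
  have a5 := ler_wpM2l (ltW n0') a2.
  have a6 : 0 <= (j%:R + 1) * (n%:R * n%:R ^+ j) :> R.
    by rewrite mulr_ge0 ?addr_ge0// mulr_ge0 ?exprn_ge0.
  rewrite exprS -natr1.
  by lra.
have [h1 h2] := h k.
have nk0 : 0 < n%:R ^+ k :> R by rewrite exprn_gt0.
have -> : (n ^_ k)%:R / n%:R ^+ k - 1 = ((n ^_ k)%:R - n%:R ^+ k) / n%:R ^+ k :> R.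
  by rewrite mulrBl divff// lt0r_neq0.
rewrite normrM [`|_^-1|]ger0_norm ?invr_ge0 ?(ltW nk0)// ler0_norm ?subr_le0// opprB.
by rewrite ler_pdivrMr// mulrAC ler_pdivlMr// mulrC.
Qed.

End Bonferroni.

(** * Binomial moments of the overlap *)

Section FactorialMoments.
Context (R : realFieldType) (V J : finType) (c : V -> J) (m n : nat).
Context (card_class : forall i, #|[set z | c z == i]| = m).
Context (n_def : (#|J| * m = 2 * n)%N) (J_gt1 : (1 < #|J|)%N).
Let e : rel V := fun u v => c u != c v.
Let PM := matchings_of e [set: V].
Context (M : {set {set V}}) (M_PM : M \in PM).
Let L : R := (#|J|%:R - 1) * m%:R.

(** The [k]-th factorial moment of the overlap with a uniform matching, divided by [k!]. *)
Definition overlap_moment k : R := (\sum_(T in PM) 'C(#|M :&: T|, k)%:R) / #|PM|%:R.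
Definition overlap_prob k : R := #|[set T in PM | #|M :&: T| == k]|%:R / #|PM|%:R.

Lemma card_matchings_gt0 : 0 < #|PM|%:R :> R.
Proof. by rewrite ltr0n card_gt0; apply/set0Pn; exists M. Qed.

Lemma overlap_prob_bonferroni k I :
  `|overlap_prob k - \sum_(i < I) (-1) ^+ i * 'C(k + i, k)%:R * overlap_moment (k + i)|
    <= 'C(k + I, k)%:R * overlap_moment (k + I).
Proof.
have PM0 := card_matchings_gt0.
rewrite /overlap_prob /overlap_moment; under eq_bigr do rewrite mulrA mulr_sumr.
rewrite -mulr_suml -mulrBl normrM [`|_^-1|]ger0_norm ?invr_ge0 ?(ltW PM0)//.
rewrite mulrA ler_wpM2r ?invr_ge0 ?(ltW PM0)// exchange_big /= mulr_sumr.
have -> : #|[set T in PM | #|M :&: T| == k]|%:R = \sum_(T in PM) (#|M :&: T| == k)%:R :> R.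
  rewrite -sum1_card natr_sum big_mkcond [RHS]big_mkcond /=.
  by apply: eq_bigr => T _; rewrite [in LHS]inE; case: (T \in PM) => //=; case: eqP.
rewrite -sumrB; apply: le_trans (ler_norm_sum _ _ _) _.
by apply: ler_sum => T _; exact: bonferroni.
Qed.

Lemma card_perfect_matching : #|M| = n.
Proof.
have := M_PM; rewrite inE => /andP[/fintype.subsetP Me MV].
have : #|[set: V]| = (#|M| * 2)%N.
  apply: card_uniform_partition MV => E /Me /edgesP[u [v [cuv ->]]].
  by rewrite cards2; suff -> : u != v by []; apply: contraNneq cuv => ->.
have -> : #|[set: V]| = (#|J| * m)%N.
  by rewrite -(@card_colours _ _ c m card_class predT); apply: eq_card => z; rewrite !inE.
by rewrite n_def mulnC => /eqP; rewrite eqn_pmul2r// => /eqP.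
Qed.

(** Double counting of the pairs [(T, S)] with [S] a [k]-subset of [M :&: T]. *)
Lemma sum_bin_overlap k :
  \sum_(T in PM) 'C(#|M :&: T|, k)%:R =
  \sum_(S : {set {set V}} | (S \subset M) && (#|S| == k))
     #|[set T in PM | S \subset T]|%:R :> R.
Proof.
transitivity (\sum_(T in PM) \sum_(S : {set {set V}} | (S \subset M) && (#|S| == k))
    (S \subset T)%:R : R).
  apply: eq_bigr => T _; rewrite -cards_draws -sum1_card natr_sum.
  rewrite big_mkcond [RHS]big_mkcond /=; apply: eq_bigr => S _.
  rewrite inE finset.subsetI.
  by case: (S \subset M) => //=; case: (S \subset T) => //=; case: eqP.
rewrite exchange_big /=; apply: eq_bigr => S _.
rewrite -sum1_card natr_sum big_mkcond [RHS]big_mkcond /=; apply: eq_bigr => T _.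
by rewrite [in RHS]inE; case: (T \in PM) => //=; case: (S \subset T).
Qed.

(** With at least two classes [m <= n], while [L = 2 n - m]. Hence [n / L <= 1], which keeps the
    errors below independent of the number of classes. *)
Lemma edges_le_degree : n%:R <= L.
Proof.
have rm : #|J|%:R * m%:R = 2 * n%:R :> R by rewrite -!natrM n_def.
have : 2 * m%:R <= #|J|%:R * m%:R :> R by rewrite ler_wpM2r// ler_nat.
by rewrite /L; lra.
Qed.

(** The comparison passes through ['C(n, k) / L ^ k]: each of the ['C(n, k)] sets of [k] edges of
    [M] lies in about a fraction [1 / L ^ k] of the matchings, and ['C(n, k)] is close to
    [n ^ k / k!]. *)
Lemma overlap_moment_estimate k : (36 * k + 8 <= n)%N ->
  `|overlap_moment k - (n%:R / L) ^+ k / k`!%:R| <=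
    (36 * k%:R * 2 ^+ k + k%:R ^+ 2) / n%:R.
Proof.
move=> n_large; have PM0 := card_matchings_gt0.
have n_gt0 : (0 < n)%N by rewrite (leq_trans _ n_large)// addn_gt0 orbT.
have n0 : 0 < n%:R :> R by rewrite ltr0n.
have nL := edges_le_degree; have L0 : 0 < L by exact: lt_le_trans nL.
have Lk : 0 < L ^+ k by rewrite exprn_gt0.
have nk : 0 < n%:R ^+ k :> R by rewrite exprn_gt0.
have fk : 1 <= k`!%:R :> R by rewrite ler1n fact_gt0.
have fk0 : 0 < k`!%:R :> R by rewrite ltr0n fact_gt0.
have binE : 'C(n, k)%:R = (n ^_ k)%:R / k`!%:R :> R.
  by rewrite -bin_ffact natrM mulfK// lt0r_neq0.
have ff_le : (n ^_ k)%:R <= n%:R ^+ k :> R.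
  rewrite -natrX ler_nat; elim: k {n_large Lk nk fk fk0 binE} => // k IHk.
  by rewrite ffactnSr expnSr leq_mul// leq_subr.
have nkLk : n%:R ^+ k <= L ^+ k by rewrite lerXn2r ?nnegrE// ltW.
have bin_le : 'C(n, k)%:R / L ^+ k <= 1.
  rewrite ler_pdivrMr// mul1r binE ler_pdivrMr//.
  apply: (le_trans ff_le); apply: (le_trans nkLk); rewrite ler_peMr//; exact: ltW.
have bin_sum : 'C(n, k)%:R =
    \sum_(S : {set {set V}} | (S \subset M) && (#|S| == k)) 1 :> R.
  rewrite -card_perfect_matching -cards_draws -sum1_card natr_sum.
  by apply: eq_bigl => S; rewrite inE.
have first_part : `|overlap_moment k - 'C(n, k)%:R / L ^+ k| <= 36 * k%:R * 2 ^+ k / n%:R.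
  have -> : overlap_moment k - 'C(n, k)%:R / L ^+ k =
     (\sum_(S : {set {set V}} | (S \subset M) && (#|S| == k))
       (L ^+ k * #|[set T in PM | S \subset T]|%:R - #|PM|%:R)) / (L ^+ k * #|PM|%:R).
    rewrite sumrB -mulr_sumr -sum_bin_overlap sumr_const mulrBl.
    rewrite /overlap_moment; set s := \sum_(_ in PM) _.
    have -> : #|[pred S : {set {set V}} | (S \subset M) && (#|S| == k)]| = 'C(n, k).
      by rewrite -card_perfect_matching -cards_draws; apply: eq_card => S; rewrite !inE.
    rewrite -[#|PM|%:R *+ _]mulr_natl.
    by field; rewrite !lt0r_neq0.
  rewrite normrM normfV (gtr0_norm (mulr_gt0 Lk PM0)) ler_pdivrMr ?mulr_gt0//.
  rewrite -(ler_pM2l n0).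
  apply: (@le_trans _ _ (n%:R * ('C(n, k)%:R * (36 * k%:R * 2 ^+ k / n%:R * #|PM|%:R)))).
    rewrite ler_wpM2l//; apply: le_trans (ler_norm_sum _ _ _) _.
    rewrite bin_sum mulr_suml; apply: ler_sum => S /andP[SM /eqP Sk]; rewrite mul1r.
    (* Nothing is deleted from [[set: V]] at the start, so [K = 2 k] suffices; hence
       [36 = 2 * 18]. *)
    have := @matchings_of_sup_estimate R V J c m n card_class n_def J_gt1 k (2 * k)
      [set: V] M S M_PM SM Sk.
    rewrite finset.setCT cards0 add0n => /(_ (leqnn _)).
    have n1 : (8 * (2 * k + 1) <= n)%N by clear -n_large; lia.
    have n2 : (18 * (2 * k) <= n)%N by clear -n_large; lia.
    move=> /(_ n1 n2) h; rewrite mulrAC ler_pdivlMr// mulrC; apply: le_trans h _.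
    rewrite natrM; have : 0 <= k%:R * #|PM|%:R :> R by rewrite mulr_ge0// ltW.
    by rewrite -/PM -/e; lra.
  have : 'C(n, k)%:R <= L ^+ k by rewrite -[leRHS]mul1r -ler_pdivrMr.
  have h0 : 0 <= 36 * k%:R * 2 ^+ k / n%:R * #|PM|%:R :> R.
    by rewrite !mulr_ge0 ?invr_ge0 ?exprn_ge0// ltW.
  move=> /(ler_wpM2r h0) h; rewrite ler_wpM2l//.
  by apply: le_trans h _; rewrite mulrCA.
have second_part : `|'C(n, k)%:R / L ^+ k - (n%:R / L) ^+ k / k`!%:R| <= k%:R ^+ 2 / n%:R.
  have -> : 'C(n, k)%:R / L ^+ k - (n%:R / L) ^+ k / k`!%:R =
      ((n ^_ k)%:R / n%:R ^+ k - 1) * ((n%:R ^+ k / L ^+ k) / k`!%:R).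
    by rewrite binE expr_div_n; field; rewrite !lt0r_neq0.
  rewrite normrM; apply: (le_trans _ (ffact_approx R k n_gt0)).
  rewrite ler_piMr// ger0_norm ?divr_ge0 ?(ltW fk0) ?(ltW nk) ?(ltW Lk)//.
  rewrite ler_pdivrMr// mul1r (le_trans _ fk)// ler_pdivrMr// mul1r //.
have -> : overlap_moment k - (n%:R / L) ^+ k / k`!%:R =
  (overlap_moment k - 'C(n, k)%:R / L ^+ k) + ('C(n, k)%:R / L ^+ k - (n%:R / L) ^+ k / k`!%:R).
  by ring.
apply: le_trans (ler_normD _ _) _; rewrite mulrDl; exact: lerD.
Qed.

End FactorialMoments.

(** * Poisson limit and total variation *)

Local Open Scope classical_set_scope.

Section PoissonLimit.
Context (R : realType).

(** Termwise comparison with the series at [1], which makes the tail bound uniform in [x]. *)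
Lemma expR_series_tail (x : R) I : `|x| <= 1 ->
  `|expR x - series (exp_coeff x) I| <= expR 1 - series (exp_coeff (1 : R)) I.
Proof.
move=> x1.
have cvgx : `|series (exp_coeff x) J - series (exp_coeff x) I| @[J --> \oo] -->
    `|expR x - series (exp_coeff x) I|.
  by apply: cvg_norm; apply: cvgB; [exact: is_cvg_series_exp_coeff|exact: cvg_cst].
have cvg1 : series (exp_coeff (1 : R)) J - series (exp_coeff (1 : R)) I @[J --> \oo] -->
    expR 1 - series (exp_coeff (1 : R)) I.
  by apply: cvgB; [exact: is_cvg_series_exp_coeff|exact: cvg_cst].
apply: (ler_cvg_to cvgx cvg1); near=> J.
have IJ : (I <= J)%N by near: J; exact: nbhs_infty_ge.
rewrite !sub_series_geq//; apply: le_trans (ler_norm_sum _ _ _) _.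
apply: ler_sum => i _; rewrite /exp_coeff /= normrM normrX normfV (@ger0_norm _ i`!%:R)//.
by rewrite ler_wpM2r ?invr_ge0// expr1n exprn_ile1.
Unshelve. all: by end_near. Qed.

(** [lam n] is bounded but need not converge, so the limit is stated against moving Poisson weights.
    Truncation at [I] leaves finitely many moment errors, vanishing in [n], and tails bounded in
    terms of [I] alone; [I] is fixed first. *)
Lemma method_of_moments (a mu : nat -> nat -> R) (lam : nat -> R) :
  (forall n, 0 <= lam n <= 1) ->
  (forall n k I,
    `|a n k - \sum_(i < I) (-1) ^+ i * 'C(k + i, k)%:R * mu n (k + i)|
      <= 'C(k + I, k)%:R * mu n (k + I)) ->
  (forall k, mu n k - lam n ^+ k / k`!%:R @[n --> \oo] --> (0 : R)) ->
  forall k, a n k - lam n ^+ k / k`!%:R * expR (- lam n) @[n --> \oo] --> (0 : R).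
Proof.
move=> lam01 bonf mom k.
pose nu n j := lam n ^+ j / j`!%:R.
(* The range [I.+1] includes the index [I] of the Bonferroni remainder. *)
pose err I n := \sum_(i < I.+1) 'C(k + i, k)%:R * `|mu n (k + i) - nu n (k + i)|.
have err0 I : err I n @[n --> \oo] --> (0 : R).
  rewrite [X in _ --> X](_ : 0 = \sum_(i < I.+1) 'C(k + i, k)%:R * `|0 : R|); last first.
    by rewrite big1// => i _; rewrite normr0 mulr0.
  apply: cvg_big => [|i _]; [exact: add_continuous|apply: cvgM]; first exact: cvg_cst.
  by apply: cvg_norm; exact: mom.
(* Thus the alternating sum of the [nu] is [nu n k] times the truncated series of
   [expR (- lam n)]. *)
have bin_nu n i : 'C(k + i, k)%:R * nu n (k + i) = nu n k * (lam n ^+ i / i`!%:R).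
  rewrite /nu -(@bin_fact (k + i) k) ?leq_addr// addKn !natrM exprD.
  have b0 : 'C(k + i, k)%:R != 0 :> R by rewrite pnatr_eq0 -lt0n bin_gt0 leq_addr.
  have f1 : k`!%:R != 0 :> R by rewrite pnatr_eq0 -lt0n fact_gt0.
  have f2 : i`!%:R != 0 :> R by rewrite pnatr_eq0 -lt0n fact_gt0.
  by field; rewrite b0 f1 f2.
have term01 n j : 0 <= lam n ^+ j / j`!%:R <= 1.
  have /andP[l0 l1] := lam01 n.
  rewrite divr_ge0 ?exprn_ge0//= ler_pdivrMr ?ltr0n ?fact_gt0// mul1r.
  by rewrite (@le_trans _ _ 1) ?exprn_ile1// ler1n fact_gt0.
have bound n I : `|a n k - nu n k * expR (- lam n)| <=
    err I n + (1 / I`!%:R + (expR 1 - series (exp_coeff (1 : R)) I)).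
  have /andP[l0 l1] := lam01 n.
  have /andP[nu0 nu1] : 0 <= nu n k <= 1 by exact: term01.
  have -> : a n k - nu n k * expR (- lam n) =
    (a n k - \sum_(i < I) (-1) ^+ i * 'C(k + i, k)%:R * mu n (k + i)) +
    (\sum_(i < I) (-1) ^+ i * 'C(k + i, k)%:R * (mu n (k + i) - nu n (k + i))) -
    nu n k * (expR (- lam n) - series (exp_coeff (- lam n)) I).
    have -> : nu n k * (expR (- lam n) - series (exp_coeff (- lam n)) I) =
        nu n k * expR (- lam n) - \sum_(i < I) (-1) ^+ i * 'C(k + i, k)%:R * nu n (k + i).
      rewrite mulrBr /series /= big_mkord mulr_sumr; congr (_ - _).
      by apply: eq_bigr => i _; rewrite -mulrA bin_nu /exp_coeff /= [(- lam n) ^+ i]exprNn; ring.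
    under [X in _ + X - _]eq_bigr do rewrite mulrBr.
    by rewrite sumrB; ring.
  apply: le_trans (ler_normB _ _) _.
  rewrite addrA lerD//; last first.
    rewrite normrM (ger0_norm nu0) -[leRHS]mul1r ler_pM//.
    by apply: expR_series_tail; rewrite normrN ger0_norm.
  apply: le_trans (ler_normD _ _) _; rewrite [leLHS]addrC /err big_ord_recr /= -[leRHS]addrA.
  apply: lerD.
    apply: le_trans (ler_norm_sum _ _ _) _; apply: ler_sum => i _.
    by rewrite !normrM normrX normrN1 expr1n mul1r (@ger0_norm _ 'C(_, _)%:R).
  apply: (le_trans (bonf n k I)).
  rewrite -[mu n (k + I)%N in leLHS](subrK (nu n (k + I)%N)) mulrDr lerD//.
    by rewrite ler_wpM2l// ler_norm.
  (* The Poisson part of the remainder is [nu n k] times [lam n ^ I / I!], hence at most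
     [1 / I!]. *)
  rewrite bin_nu -[leRHS]mul1r ler_pM ?divr_ge0 ?exprn_ge0//.
  by rewrite ler_wpM2r ?invr_ge0// exprn_ile1.
have tail0 : 1 / I`!%:R + (expR 1 - series (exp_coeff (1 : R)) I) @[I --> \oo] --> (0 : R).
  rewrite [X in _ --> X](_ : 0 = 0 + (expR 1 - expR 1) :> R); last by rewrite subrr addr0.
  apply: cvgD.
    rewrite (_ : (fun I : nat => 1 / I`!%:R) = exp_coeff (1 : R)).
      exact: cvg_exp_coeff.
    by apply/funext => I; rewrite /exp_coeff /= expr1n.
  by apply: cvgB; [exact: cvg_cst|exact: is_cvg_series_exp_coeff].
apply/cvgrPdist_le => eps eps0.
have e2 : 0 < eps / 2 by rewrite divr_gt0.
have /cvgrPdist_le/(_ _ e2)[I _ /(_ I (leqnn I)) HI] := tail0.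
have /cvgrPdist_le/(_ _ e2) := err0 I; apply: filterS => n Hn.
rewrite sub0r normrN; apply: (le_trans (bound n I)).
rewrite !sub0r !normrN in HI Hn.
rewrite [leRHS]splitr; apply: lerD; first exact: le_trans (ler_norm _) Hn.
exact: le_trans (ler_norm _) HI.
Qed.

End PoissonLimit.

(** * Total variation through finitely many point masses *)

Section TotalVariation.
Context (R : realType).

(** An [esum] is a supremum of finite sums, and each of these is the measure of a finite disjoint
    union inside [D]. *)
Lemma esum_preimage_le d (T : measurableType d) (P : probability T R) (X : T -> int)
    (C : set int) (D : set T) :
  (forall k, measurable (X @^-1` [set k])) -> measurable D -> X @^-1` C `<=` D ->
  (\esum_(k in C) P (X @^-1` [set k]) <= P D)%E.
Proof.
move=> mX mD CD; apply: ge_ereal_sup => _ [F [finF FC] <-].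
rewrite -measure_fsbig//; last first.
  by move=> i j _ _ [x [/= <- <-]].
apply: le_measure; rewrite ?inE//.
  by rewrite fsbig_finite//; apply: bigsetU_measurable.
move=> x; rewrite fsbig_setU// => -[k Fk xk].
by apply: CD; rewrite /= xk; exact: FC.
Qed.

(** The complement is taken in [int], so it bounds the mass of the negative values along with the
    upper tail. *)
Lemma probability_not_below d (T : measurableType d) (P : probability T R) (X : T -> int)
    (a : nat -> R) (K : nat) :
  (forall k, measurable (X @^-1` [set k])) ->
  (forall i : nat, P (X @^-1` [set i%:Z]) = (a i)%:E) ->
  (\esum_(k in ~` [set i%:Z | i in `I_K]) P (X @^-1` [set k])
    <= (1 - \sum_(i < K) a i)%:E)%E.
Proof.
move=> mX Pa.
pose U := \big[setU/set0]_(i < K) (X @^-1` [set (i : nat)%:Z]).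
have mU : measurable U by apply: bigsetU_measurable.
have -> : (1 - \sum_(i < K) a i)%:E = P (~` U).
  rewrite probability_setC// EFinB; congr (_ - _)%E.
  rewrite /U (@measure_bigsetU _ _ _ P (fun i : nat => X @^-1` [set i%:Z]))//.
    by rewrite -sumEFin; apply: eq_bigr => i _; exact/esym/Pa.
  by move=> i j _ _ [x [/= ->]] [].
apply: esum_preimage_le => //; first exact: measurableC.
move=> x Cx; rewrite /U -(bigcup_mkord _ (fun i : nat => X @^-1` [set i%:Z])) => -[i /= iK xi].
by apply: Cx; exists i.
Qed.

(** On [0, ..., K - 1] the point masses are compared directly; elsewhere [|p - q| <= p + q] leaves
    the two remaining masses. *)
Lemma dTV_le d (T : measurableType d) (P : probability T R) (X : T -> int)
    d' (T' : measurableType d') (Q : probability T' R) (Y : T' -> int)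
    (a b : nat -> R) (K : nat) :
  (forall k, measurable (X @^-1` [set k])) -> (forall k, measurable (Y @^-1` [set k])) ->
  (forall i : nat, P (X @^-1` [set i%:Z]) = (a i)%:E) ->
  (forall i : nat, Q (Y @^-1` [set i%:Z]) = (b i)%:E) ->
  (dTV P X Q Y <= (2^-1 * (\sum_(i < K) `|a i - b i| +
    ((1 - \sum_(i < K) a i) + (1 - \sum_(i < K) b i))))%:E)%E.
Proof.
move=> mX mY Pa Qb; rewrite /dTV EFinM; apply: lee_wpmul2l.
  by rewrite lee_fin invr_ge0.
rewrite (esumID [set i%:Z | i in `I_K]) => [|k _]; last exact: abse_ge0.
rewrite !setTI EFinD; apply: leeD.
  rewrite esum_image; last by move=> i j _ _ [].
  rewrite esum_fset//= -?fsbig_ord.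
  by rewrite -sumEFin; apply: lee_sum => i _; rewrite /= Pa Qb.
rewrite EFinD.
have hP := probability_not_below K mX Pa; have hQ := probability_not_below K mY Qb.
apply: le_trans (leeD hP hQ); rewrite -esumD//.
apply: le_esum => k _; apply: le_trans (lee_abs_sub _ _) _.
by rewrite !gee0_abs.
Qed.

End TotalVariation.

(** * Laws of the overlap and of the Poisson variable *)

Section UniformMatchings.
Context (R : realType).

(** As [S] is finite, the preimage of [B] is a finite disjoint union of fibres, whose probabilities
    are given. *)
Lemma uniformly_distributed_preimage d (T : measurableType d) (P : probability T R)
    (S : finType) (A B : {set S}) (Z : T -> S) :
  uniformly_distributed P A Z ->
  measurable (Z @^-1` [set s | s \in B]) /\
  P (Z @^-1` [set s | s \in B]) = (#|[set s in A | s \in B]%SET|%:R / #|A|%:R)%:E.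
Proof.
move=> Zunif.
have -> : Z @^-1` [set s | s \in B] = \big[setU/set0]_(s <- enum B) Z @^-1` [set s].
  apply/seteqP; split => [w /= wB|w].
    by rewrite -bigcup_seq; exists (Z w); rewrite //= mem_enum.
  by rewrite -bigcup_seq => -[s /=]; rewrite mem_enum => sB ->.
split; first by apply: bigsetU_measurable => s _; exact: (Zunif s).1.
rewrite fsbig_seq ?enum_uniq// measure_fsbig//=; last 2 first.
- by move=> s _; exact: (Zunif s).1.
- by move=> s t _ _ [w [/= <- <-]].
rewrite -fsbig_seq ?enum_uniq// big_enum /=.
under eq_bigr do rewrite (Zunif _).2.
rewrite sumEFin; congr (_%:E).
rewrite -big_mkcondr /= sumr_const -[LHS]mulr_natl; congr (_%:R * _).
by apply: eq_card => s; rewrite !inE andbC.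
Qed.

Lemma Po_preimage (lam : R) (i : nat) : 0 < lam ->
  Po lam (Posz @^-1` [set i%:Z]) = (lam ^+ i / i`!%:R * expR (- lam))%:E.
Proof.
move=> lam0.
have -> : Posz @^-1` [set i%:Z] = [set i].
  by apply/seteqP; split => j /=; [move=> []|move=> ->].
rewrite /Po /= /poisson_prob lam0 esum_set1 /poisson_pmf ?lam0//.
by rewrite lee_fin !mulr_ge0 ?expR_ge0 ?invr_ge0 ?exprn_ge0 ?(ltW lam0).
Qed.

(** Writing [1] as [expR lam] times [expR (- lam)] turns the left side into an exponential tail
    times a factor at most [1]. The resulting bound is uniform in [lam]. *)
Lemma sum_poisson_ge (lam : R) K : 0 <= lam <= 1 ->
  1 - \sum_(i < K) lam ^+ i / i`!%:R * expR (- lam) <=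
  expR 1 - series (exp_coeff (1 : R)) K.
Proof.
move=> /andP[l0 l1].
have -> : \sum_(i < K) lam ^+ i / i`!%:R * expR (- lam) =
    series (exp_coeff lam) K * expR (- lam).
  by rewrite /series /= big_mkord mulr_suml.
rewrite -[X in X - _](expRxMexpNx_1 lam) -mulrBl.
have lam_norm : `|lam| <= 1 by rewrite ger0_norm.
apply: (le_trans _ (expR_series_tail K lam_norm)).
apply: le_trans (ler_norm _) _; rewrite normrM ler_piMr//.
by rewrite ger0_norm ?expR_ge0// -expR0 ler_expR oppr_le0.
Qed.

Lemma card_multipartite_class r m (i : 'I_r) :
  #|[set z : multipartite_vertex r m | z.1 == i]%SET| = m.
Proof.
rewrite -[RHS]card_ord -cardsT -(card_imset _ (f := fun a : 'I_m => (i, a))).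
  apply: eq_card => -[j a]; rewrite !inE /=; apply/eqP/imsetP => [->|[b _ [-> _]]//].
  by exists a.
by move=> a b [].
Qed.

End UniformMatchings.

(** * Convergence in total variation *)

Theorem theorem1p2 (R : realType) (r : nat -> nat)
    (r_ge2 : forall n, (2 <= r n)%N)
    (r_dvd : forall n, (r n %| 2 * n)%N)
    (M : forall n, {set {set multipartite_vertex (r n) (2 * n %/ r n)}})
    (M_pm : forall n,
       perfect_matching (@complete_multipartite (r n) (2 * n %/ r n)) (M n))
    (d : nat -> measure_display) (T : forall n, measurableType (d n))
    (P : forall n, probability (T n) R)
    (Rn : forall n, T n -> {set {set multipartite_vertex (r n) (2 * n %/ r n)}})
    (Rn_unif : forall n, uniformly_distributed (P n)
       (perfect_matchings (@complete_multipartite (r n) (2 * n %/ r n))) (Rn n)) :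
  dTV (P n) (fun w => #|M n :&: Rn n w|%:Z)
      (Po ((r n)%:R / (2 * (r n)%:R - 2))) Posz @[n --> \oo] --> 0%E.
Proof.
pose c n (z : multipartite_vertex (r n) (2 * n %/ r n)) := z.1.
pose lam n : R := (r n)%:R / (2 * (r n)%:R - 2).
have r2 n : 2 <= (r n)%:R :> R by rewrite ler_nat.
have lam_gt0 n : 0 < lam n by have := r2 n; rewrite /lam => ?; apply: divr_gt0; lra.
(* [r >= 2] gives [r <= 2 r - 2]; this bound takes the place of convergence of [lam n]. *)
have lam_le1 n : lam n <= 1.
  by have := r2 n; rewrite /lam => ?; rewrite ler_pdivrMr; lra.
have lam01 n : 0 <= lam n <= 1 by rewrite lam_le1 ltW.
have n_def n : (#|{: 'I_(r n)}| * (2 * n %/ r n) = 2 * n)%N.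
  by rewrite card_ord mulnC divnK.
have r_gt1 n : (1 < #|{: 'I_(r n)}|)%N by rewrite card_ord.
have M_PM n : M n \in matchings_of (fun u v => c n u != c n v) [set: _]%SET.
  by rewrite inE; exact: M_pm.
pose a n k := overlap_prob R (@c n) (M n) k.
pose mu n k := overlap_moment R (@c n) (M n) k.
have mom k : mu n k - lam n ^+ k / k`!%:R @[n --> \oo] --> (0 : R).
  pose C : R := 36 * k%:R * 2 ^+ k + k%:R ^+ 2.
  (* The harmonic sequence is indexed by [n.+1]; the factor [2] absorbs the shift, since
     [C / n <= 2 C / (n + 1)] for [n >= 1]. *)
  have C_cvg : 2 * C * n.+1%:R^-1 @[n --> \oo] --> (0 : R).
    by rewrite -(mulr0 (2 * C)); apply: cvgM; [exact: cvg_cst|exact: cvg_harmonic].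
  apply/norm_cvg0P; apply: (squeeze_cvgr _ (cvg_cst 0) C_cvg); near=> n.
  rewrite normr_ge0 /=.
  have n_large : (36 * k + 8 <= n)%N by near: n; exact: nbhs_infty_ge.
  have := overlap_moment_estimate R (@card_multipartite_class _ _) (n_def n) (r_gt1 n)
    (M_PM n) n_large.
  have n_gt0 : 0 < n%:R :> R by rewrite ltr0n (leq_trans _ n_large)// addn_gt0 orbT.
  have -> : n%:R / ((#|{: 'I_(r n)}|%:R - 1) * (2 * n %/ r n)%:R) = lam n.
    have rm : (r n)%:R * (2 * n %/ r n)%:R = 2 * n%:R :> R.
      by rewrite -!natrM; congr _%:R; have := n_def n; rewrite card_ord.
    rewrite card_ord /lam; have := r2 n.
    move: ((r n)%:R : R) ((2 * n %/ r n)%:R : R) (n%:R : R) rm n_gt0 => rho m N rm N0 rho2.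
    have m0 : m != 0 by apply: contraTneq N0 => m0; move: rm; rewrite m0 mulr0; lra.
    have -> : N = rho * m / 2 by rewrite rm mulrC mulrA mulVf ?mul1r.
    by field; rewrite m0 !gt_eqF//; lra.
  move=> h; apply: (le_trans h); rewrite -/C.
  have C0 : 0 <= C by rewrite addr_ge0// !mulr_ge0 ?exprn_ge0.
  have n_ge1 : 1 <= n%:R :> R by rewrite ler1n -(ltr0n R).
  rewrite ler_pdivrMr// mulrAC ler_pdivlMr// -natr1.
  by have := ler_wpM2l C0 n_ge1; lra.
have probs := method_of_moments lam01 _ mom.
have {}probs k : a n k - lam n ^+ k / k`!%:R * expR (- lam n) @[n --> \oo] --> (0 : R).
  by apply: probs => n j I; exact: overlap_prob_bonferroni (M_PM n) _ _.
pose p n k := lam n ^+ k / k`!%:R * expR (- lam n).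
have PX n : forall k : int,
    measurable ((fun w => #|M n :&: Rn n w|%:Z) @^-1` [set k]) /\
    (forall i : nat, k = i%:Z ->
      P n ((fun w => #|M n :&: Rn n w|%:Z) @^-1` [set k]) = (a n i)%:E).
  move=> k; have -> : (fun w => #|M n :&: Rn n w|%:Z) @^-1` [set k] =
      Rn n @^-1` [set s | s \in [set s | #|M n :&: s|%:Z == k]%SET].
    by apply/seteqP; split => w /=; rewrite inE => /eqP.
  have [mX PXk] := uniformly_distributed_preimage
    [set s | #|M n :&: s|%:Z == k]%SET (Rn_unif n).
  split=> // i ki; rewrite PXk /a /overlap_prob ki; congr ((_%:R / _)%:E).
  by apply: eq_card => s; rewrite !inE.
have bound K n : (dTV (P n) (fun w => #|M n :&: Rn n w|%:Z) (Po (lam n)) Posz <=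
    (\sum_(i < K) `|a n i - p n i| + (expR 1 - series (exp_coeff (1 : R)) K))%:E)%E.
  apply: le_trans (dTV_le (a := a n) (b := p n) K _ _ _ _) _.
  - by move=> k; exact: (PX n k).1.
  - by [].
  - by move=> i; exact: (PX n i%:Z).2.
  - by move=> i; exact: Po_preimage.
  rewrite lee_fin.
  have tail := sum_poisson_ge K (lam01 n); rewrite -/(p n _) in tail.
  (* This trades the tail of the overlap for the Poisson tail plus the sum of the differences. Both
     quantities then occur twice, which cancels the factor [1 / 2]. *)
  have : \sum_(i < K) p n i - \sum_(i < K) a n i <= \sum_(i < K) `|a n i - p n i|.
    rewrite -sumrB; apply: ler_sum => i _; rewrite distrC; exact: ler_norm.
  rewrite -/(p n) in tail *.
  by move: (\sum_(i < K) p n i) (\sum_(i < K) a n i) tail => *; lra.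
have dTV_ge0 n : (0 <= dTV (P n) (fun w => #|M n :&: Rn n w|%:Z) (Po (lam n)) Posz)%E.
  apply: mule_ge0; first by rewrite lee_fin invr_ge0.
  by apply: esum_ge0 => k _; exact: abse_ge0.
(* Already at [K = 0] the bound is a real number. *)
have dTV_fin n : dTV (P n) (fun w => #|M n :&: Rn n w|%:Z) (Po (lam n)) Posz \is a fin_num.
  by rewrite ge0_fin_numE//; apply: le_lt_trans (bound 0%N n) _; rewrite ltry.
apply/fine_cvgP; split; first by apply: nearW => n; exact: dTV_fin.
apply/cvgrPdist_le => eps eps0.
have e2 : 0 < eps / 2 by rewrite divr_gt0.
(* The cutoff [K] is chosen first, from the tail bound uniform in [n]; then [n] is taken large for
   the finitely many point masses. *)
have : expR 1 - series (exp_coeff (1 : R)) K @[K --> \oo] --> (0 : R).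
  rewrite -[X in _ --> X](subrr (expR (1 : R))).
  by apply: cvgB; [exact: cvg_cst|exact: is_cvg_series_exp_coeff].
move/cvgrPdist_le/(_ _ e2) => [K _ /(_ K (leqnn K))]; rewrite /= sub0r normrN => tailK.
have : \sum_(i < K) `|a n i - p n i| @[n --> \oo] --> (0 : R).
  rewrite [X in _ --> X](_ : 0 = \sum_(i < K) `|0 : R|); last first.
    by rewrite big1// => i _; rewrite normr0.
  by apply: cvg_big => [|i _]; [exact: add_continuous|apply: cvg_norm; exact: probs].
move/cvgrPdist_le/(_ _ e2); apply: filterS => n; rewrite !sub0r !normrN => near_n.
rewrite /= ger0_norm ?fine_ge0// -lee_fin fineK//; apply: le_trans (bound K n) _.
rewrite lee_fin [leRHS]splitr; apply: lerD; first exact: le_trans (ler_norm _) near_n.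
exact: le_trans (ler_norm _) tailK.
Unshelve. all: by end_near.
Qed.
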